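(* Fix $c>0$, $\lambda>1$ and one of the six models. For every $N$ and every $1\le N_1,N_2\le N-1$ with $N_1+N_2=N$, $$\mathbb{E}\big[\log Z(\mathbb{G}(N,\lfloor cN\rfloor))\big]\ge\mathbb{E}\big[\log Z(\mathbb{G}(N_1,\mathcal{M}_1))\big]+\mathbb{E}\big[\log Z(\mathbb{G}(N_2,\mathcal{M}_2))\big],$$ where $\mathcal{M}_1\sim\mathrm{Bi}(\lfloor cN\rfloor,N_1/N)$ and $\mathcal{M}_2=\lfloor cN\rfloor-\mathcal{M}_1\sim\mathrm{Bi}(\lfloor cN\rfloor,N_2/N)$.
   Context: Let $K\ge2$, $\chi=\{0,\dots,q-1\}$. $\mathbb{G}(n,m)$ on an $n$-element node set $V$: $m$ directed hyperedges chosen independently and uniformly from $V^K$. For a hypergraph $G=(V,E)$ with node potentials $H_i$ and edge potentials $H_e:\chi^K\to\mathbb{R}\cup\{-\infty\}$, $H(x)=\sum_iH_i(x_i)+\sum_{e\in E}H_e(x_e)$ and $Z(G)=\sum_{x\in\chi^V}\lambda^{H(x)}$, $\lambda^{-\infty}=0$. Models: Independent set ($K=2,q=2$, $H_i(1)=1,H_i(0)=0$, $H_e(1,1)=-\infty$, else $0$); MAX-CUT ($K=2,q=2$, $H_i\equiv0$, $H_e(x,y)=\mathbf 1[x\ne y]$); anti-ferromagnetic Ising ($K=2,q=2$, fixed $\beta>0,B\in\mathbb{R}$, $H_i(0)=-B,H_i(1)=B$, $H_e(x,y)=-\beta$ if $x=y$, $\beta$ otherwise); $q$-Coloring ($K=2$,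 $H_i\equiv0$, $H_e(x,y)=\mathbf 1[x\ne y]$); K-SAT ($q=2$, $H_i\equiv0$, independent uniform $a_e\in\{0,1\}^K$, $H_e(a_e)=0$, $1$ otherwise); NAE-K-SAT ($H_e(a_e)=H_e(\mathbf1-a_e)=0$, $1$ otherwise). $\mathrm{Bi}(n,\theta)$ is the binomial distribution. *)

(* Defs.v *)
From mathcomp Require Import all_boot all_order all_algebra.
From mathcomp Require Import reals exp.
Set Implicit Arguments. Unset Strict Implicit. Unset Printing Implicit Defensive.
Import Order.TTheory GRing.Theory Num.Theory.
Local Open Scope ring_scope.

Section Models.
Variable R : realType.

(* Potentials take values in R ∪ {-oo}; None stands for -oo. *)
Definition oadd (a b : option R) : option R :=
  match a, b with Some x, Some y => Some (x + y) | _, _ => None end.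

Definition owt (lam : R) (h : option R) : R :=
  match h with Some x => powR lam x | None => 0 end.

(* A model: arity K, alphabet size q, node potential, edge potential
   (the edge potential may depend on a random sign vector a_e in {0,1}^K;
   for the models without signs it ignores it). *)
Record spec := Spec {
  sK : nat;
  sq : nat;
  sh : 'I_sq -> R;
  se : {ffun 'I_sK -> bool} -> {ffun 'I_sK -> 'I_sq} -> option R }.

Inductive model :=
  | IndSet
  | MaxCut
  | AFIsing (beta B : R)
  | Coloring (q : nat)
  | KSAT (K : nat)
  | NAEKSAT (K : nat).

Definition model_ok (M : model) : Prop :=
  match M with
  | AFIsing beta _ => 0 < beta
  | Coloring q => (2 <= q)%N
  | KSAT K => (2 <= K)%N
  | NAEKSAT K => (2 <= K)%N
  | _ => True
  end.

Definition e0 : 'I_2 := ord0.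
Definition e1 : 'I_2 := ord_max.

Definition model_spec (M : model) : spec :=
  match M with
  | IndSet => @Spec 2 2 (fun s => if val s == 1%N then 1 else 0)
      (fun _ y => if (val (y e0) == 1%N) && (val (y e1) == 1%N) then None else Some 0)
  | MaxCut => @Spec 2 2 (fun _ => 0)
      (fun _ y => Some (if y e0 != y e1 then 1 else 0))
  | AFIsing beta B => @Spec 2 2 (fun s => if val s == 0%N then - B else B)
      (fun _ y => Some (if y e0 == y e1 then - beta else beta))
  | Coloring q => @Spec 2 q (fun _ => 0)
      (fun _ y => Some (if y e0 != y e1 then 1 else 0))
  | KSAT K => @Spec K 2 (fun _ => 0)
      (fun a y => Some (if [forall k, val (y k) == nat_of_bool (a k)] then 0 else 1))
  | NAEKSAT K => @Spec K 2 (fun _ => 0)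
      (fun a y => Some (if [forall k, val (y k) == nat_of_bool (a k)]
                        || [forall k, val (y k) == nat_of_bool (~~ a k)] then 0 else 1))
  end.

(* Hypergraph on V = 'I_n with m directed hyperedges E : 'I_m -> V^K,
   and sign vectors A : 'I_m -> {0,1}^K. *)
Definition Hamil (S : spec) (n m : nat)
    (E : {ffun 'I_m -> {ffun 'I_(sK S) -> 'I_n}})
    (A : {ffun 'I_m -> {ffun 'I_(sK S) -> bool}})
    (x : {ffun 'I_n -> 'I_(sq S)}) : option R :=
  oadd (Some (\sum_(i < n) sh (x i)))
       (\big[oadd/Some 0]_(e < m) se (A e) [ffun k => x (E e k)]).

Definition Zpart (S : spec) (lam : R) (n m : nat)
    (E : {ffun 'I_m -> {ffun 'I_(sK S) -> 'I_n}})
    (A : {ffun 'I_m -> {ffun 'I_(sK S) -> bool}}) : R :=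
  \sum_(x : {ffun 'I_n -> 'I_(sq S)}) owt lam (Hamil E A x).

Definition ElogZ (M : model) (lam : R) (n m : nat) : R :=
  let S := model_spec M in
  (\sum_(E : {ffun 'I_m -> {ffun 'I_(sK S) -> 'I_n}})
     \sum_(A : {ffun 'I_m -> {ffun 'I_(sK S) -> bool}}) ln (Zpart lam E A))
  / (#|{: {ffun 'I_m -> {ffun 'I_(sK S) -> 'I_n}}}|%:R
     * #|{: {ffun 'I_m -> {ffun 'I_(sK S) -> bool}}}|%:R).

Definition binprob (m : nat) (p : R) (k : nat) : R :=
  'C(m, k)%:R * p ^+ k * (1 - p) ^+ (m - k).

End Models.

(* Main.v *)
Require Import Defs.
From mathcomp Require Import all_boot all_order all_algebra.
From mathcomp Require Import reals exp.
From mathcomp Require Import all_classical topology normedtype sequences derive realfun.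
From mathcomp Require Import ring lra.
Set Implicit Arguments. Unset Strict Implicit. Unset Printing Implicit Defensive.
Import Order.TTheory GRing.Theory Num.Theory.
Import numFieldNormedType.Exports.
Local Open Scope classical_set_scope.
Local Open Scope ring_scope.

(* Interpolation: compare m independent uniform edges on V = V1 + V2 with m
   independent edges each of which lies uniformly inside V1 with probability
   N1/N and inside V2 otherwise, replacing the edges one at a time.  In the
   second ensemble the graph is a disjoint union, so log Z is additive, and the
   number of edges inside V1 is binomial.
   In all six models a new edge e multiplies Z by C (1 - t e), where t e is a
   nonnegative combination, over Gibbs samples, of products over the K ends of
   e.  The powers of t have the same form, and the mean of a product over the
   ends is the K-th power of a vertex mean; convexity of z^K together with
   ln (1 - t) = - sum_l t^l / l shows that a uniform edge gives the larger
   expected log Z.  *)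

(** * Power series of [ln (1 - t)] and convexity of powers *)

Lemma deriv_ln1B_poly (R : realType) n :
  (\poly_(i < n.+1) (i%:R^-1 : R))^`() = \poly_(i < n) 1.
Proof.
apply/polyP => i; rewrite coef_deriv !coef_poly ltnS.
by case: ifP => _; rewrite ?mul0rn // -[_^-1 *+ _]mulr_natr mulVf // pnatr_eq0.
Qed.

(** By the geometric sum the error has derivative [- (x ^+ n / (1 - x))], and it vanishes at 0
    because [0^-1 = 0] removes the constant term; the mean value theorem then bounds it. *)
Lemma ln1B_poly_bound (R : realType) n (t : R) : 0 <= t < 1 ->
  `|ln (1 - t) + (\poly_(i < n.+1) i%:R^-1).[t]| <= t ^+ n * (t / (1 - t)).
Proof.
case/andP=> t0 t1; set p := \poly_(i < n.+1) _.
pose f := fun x : R => ln (1 - x) + p.[x].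
have df (x : R) : x < 1 -> is_derive x 1 f (- (x ^+ n / (1 - x))).
  move=> x1; have x1' : 0 < 1 - x by rewrite subr_gt0.
  have d1 := is_derive1_ln x1'.
  have d2 : is_derive x (1 : R) (fun x => 1 - x : R) (- 1).
    exact: is_derive_eq
      (is_deriveB (is_derive_cst (1 : R) x 1) (is_derive_id x 1)) (sub0r _).
  have d3 : is_derive x (1 : R) (fun x => ln (1 - x)) (- (1 - x)^-1).
    by have := @is_derive1_comp _ _ (fun x => 1 - x) _ _ _ d1 d2; rewrite mulrN1.
  have d4 := is_derive_poly p x.
  apply: is_derive_eq (is_deriveD d3 d4) _.
  rewrite deriv_ln1B_poly horner_poly.
  under eq_bigr do rewrite mul1r.
  have /eqP := subrX1 x n.
  rewrite -subr_eq0 => /eqP h.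
  have hx : 1 - x != 0 by rewrite gt_eqF.
  apply: (mulfI hx).
  have -> : (1 - x) * - (x ^+ n / (1 - x)) = - x ^+ n by field.
  rewrite mulrDr mulrN mulfV //; move: h; set S := \sum_(_ < _) _; lra.
have cf : {within `[0, t]%classic, continuous f}.
  apply: derivable_within_continuous => x; rewrite in_itv /= => /andP[_ xt].
  exact: @ex_derive _ _ _ _ _ _ _ (df x (le_lt_trans xt t1)).
have f0 : f 0 = 0.
  by rewrite /f subr0 ln1 add0r horner_coef0 coef_poly /= invr0.
have [|c] := @MVT_segment _ f (fun x => - (x ^+ n / (1 - x))) 0 t t0 _ cf.
  by move=> x; rewrite in_itv /= => /andP[_ xt]; apply/df/(lt_trans xt).
rewrite in_itv /= f0 !subr0 => /andP[c0 ct] eft.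
rewrite -/(f t) eft mulNr normrN.
have c1 : 0 < 1 - c by rewrite subr_gt0 (le_lt_trans ct).
rewrite ger0_norm; last by rewrite !mulr_ge0 ?exprn_ge0 ?invr_ge0 // ltW.
rewrite -mulrA; apply: ler_pM; rewrite ?exprn_ge0 //.
- by rewrite mulr_ge0 // invr_ge0 ltW.
- by rewrite lerXn2r.
rewrite mulrC ler_wpM2l // lef_pV2 ?posrE ?subr_gt0 //; lra.
Qed.

Lemma cvg_ln1B_poly (R : realType) (t : R) : 0 <= t < 1 ->
  (\poly_(i < n.+1) i%:R^-1).[t] @[n --> \oo] --> - ln (1 - t).
Proof.
move=> t01; apply/cvgrPdist_le => e e0.
have t1 : `|t| < 1 by case/andP: t01 => ? ?; rewrite ger0_norm.
have : (fun n => t ^+ n * (t / (1 - t))) @ \oo --> 0 * (t / (1 - t)).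
  by apply: cvgM; [exact: cvg_expr|exact: cvg_cst].
rewrite mul0r => /cvgrPdist_le /(_ e e0); apply: filterS => n /=.
rewrite sub0r normrN => h.
rewrite -opprD normrN (le_trans (ln1B_poly_bound n t01)) //.
exact: le_trans (ler_norm _) h.
Qed.

(** Induction on [n]: each step leaves the defect [th (1 - th) (a - b) (a^n - b^n)], nonnegative
    because powers are monotone on nonnegative numbers. *)
Lemma convex_exprn (R : realFieldType) (th a b : R) n :
  0 <= th <= 1 -> 0 <= a -> 0 <= b ->
  (th * a + (1 - th) * b) ^+ n <= th * a ^+ n + (1 - th) * b ^+ n.
Proof.
case/andP=> th0 th1 a0 b0; have th1' : 0 <= 1 - th by rewrite subr_ge0.
elim: n => [|n IH]; first by rewrite !expr0; lra.
rewrite exprS; apply: le_trans (ler_wpM2l _ IH) _.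
  by rewrite addr_ge0 // mulr_ge0.
rewrite -subr_ge0 !exprS.
have -> : th * (a * a ^+ n) + (1 - th) * (b * b ^+ n) -
  (th * a + (1 - th) * b) * (th * a ^+ n + (1 - th) * b ^+ n) =
  th * (1 - th) * ((a - b) * (a ^+ n - b ^+ n)) by ring.
apply: mulr_ge0; first by rewrite mulr_ge0.
case: (leP a b) => ab.
  by rewrite mulr_le0 // subr_le0 // lerXn2r.
by rewrite mulr_ge0 // subr_ge0 ?lerXn2r // ltW.
Qed.

(** * Uniform averages *)

Section Average.
Variable R : numFieldType.

Definition avg (T : finType) (F : T -> R) : R := (\sum_x F x) / #|T|%:R.

Lemma eq_avg (T : finType) (F G : T -> R) : F =1 G -> avg F = avg G.
Proof. by move=> FG; rewrite /avg (eq_bigr G). Qed.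

Lemma avgD (T : finType) (F G : T -> R) :
  avg (fun x => F x + G x) = avg F + avg G.
Proof. by rewrite /avg big_split mulrDl. Qed.

Lemma avg_cst (T : finType) (c : R) : (0 < #|T|)%N -> avg (fun _ : T => c) = c.
Proof.
by move=> T0; rewrite /avg sumr_const -[c *+ _]mulr_natr mulfK // pnatr_eq0 -lt0n.
Qed.

Lemma avg_ge0 (T : finType) (F : T -> R) : (forall x, 0 <= F x) -> 0 <= avg F.
Proof. by move=> F0; rewrite mulr_ge0 ?invr_ge0 // sumr_ge0. Qed.

(** The ends of a uniform edge are independent and uniform, so the mean factorizes. *)
Lemma avg_ffun_prod (J : finType) K (h : J -> R) :
  avg (fun e : {ffun 'I_K -> J} => \prod_k h (e k)) = avg h ^+ K.
Proof.
rewrite /avg -(bigA_distr_bigA (fun (_ : 'I_K) => h)) prodr_const card_ord.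
by rewrite card_ffun card_ord natrX expr_div_n.
Qed.

End Average.

(** * Mixtures of product kernels *)

Section ProductKernels.
Variables (R : numFieldType) (J : finType) (K : nat).
Implicit Types t u : {ffun 'I_K -> J} -> R.

(** All ends share the same factor [h w], so the mean over a uniform edge is a mixture of [K]-th
    powers; the class is closed under products, hence under powers. *)
Definition prod_kernel t := exists (W : finType) (p : W -> R) (h : W -> J -> R),
  [/\ forall w, 0 <= p w, forall w j, 0 <= h w j
    & forall e, t e = \sum_w p w * \prod_k h w (e k)].

Lemma prod_kernel1 : prod_kernel (fun=> 1).
Proof.
exists unit, (fun=> 1), (fun _ _ => 1); split=> // e.
by rewrite (big_pred1 tt) => [|[] //]; rewrite mul1r big1.
Qed.

Lemma prod_kernelM t u :
  prod_kernel t -> prod_kernel u -> prod_kernel (fun e => t e * u e).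
Proof.
case=> W1 [p1 [h1 [p1_ge0 h1_ge0 te]]] [W2 [p2 [h2 [p2_ge0 h2_ge0 ue]]]].
exists (W1 * W2)%type, (fun w => p1 w.1 * p2 w.2).
exists (fun w j => h1 w.1 j * h2 w.2 j); split=> [w|w j|e]; rewrite ?mulr_ge0 //.
rewrite te ue big_distrlr pair_big /=; apply: eq_bigr => w _.
by rewrite big_split mulrACA.
Qed.

Lemma prod_kernelX t n : prod_kernel t -> prod_kernel (fun e => t e ^+ n).
Proof.
move=> tK; elim: n => [|n IH]; first exact: prod_kernel1.
by have := prod_kernelM tK IH; under eq_fun do rewrite -exprS.
Qed.

Lemma prod_kernel_ge0 t e : prod_kernel t -> 0 <= t e.
Proof.
case=> W [p [h [p0 h0 ->]]]; apply: sumr_ge0 => w _.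
by rewrite mulr_ge0 // prodr_ge0.
Qed.

End ProductKernels.

(** * One edge: uniform law against split law *)

Section SplitEdges.
Variables (R : realType) (J J1 J2 : finType) (K : nat).
Variables (i1 : J1 -> J) (i2 : J2 -> J) (th : R).
Hypothesis th01 : 0 <= th <= 1.
Hypothesis avg_split : forall h : J -> R,
  avg h = th * avg (h \o i1) + (1 - th) * avg (h \o i2).

Definition lift_edge (J' : finType) (i : J' -> J) (e : {ffun 'I_K -> J'}) :
  {ffun 'I_K -> J} := [ffun k => i (e k)].

(** The law of the image of a uniform edge over [J1] with probability [th], over [J2] otherwise. *)
Definition split_density (e : {ffun 'I_K -> J}) : R :=
  th * avg (fun e1 => (lift_edge i1 e1 == e)%:R) +
  (1 - th) * avg (fun e2 => (lift_edge i2 e2 == e)%:R).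

Lemma split_density_ge0 e : 0 <= split_density e.
Proof.
case/andP: th01 => th0 th1.
by rewrite addr_ge0 // mulr_ge0 ?subr_ge0 // avg_ge0 // => ?; rewrite ler0n.
Qed.

Lemma sum_split_density (G : {ffun 'I_K -> J} -> R) :
  \sum_e split_density e * G e =
  th * avg (G \o lift_edge i1) + (1 - th) * avg (G \o lift_edge i2).
Proof.
have avgE (J' : finType) (i : J' -> J) :
    \sum_e avg (fun e' => (lift_edge i e' == e)%:R) * G e = avg (G \o lift_edge i).
  rewrite /avg; under eq_bigr do rewrite mulrAC mulr_suml.
  rewrite -mulr_suml exchange_big /=; congr (_ / _); apply: eq_bigr => e' _.
  rewrite (bigD1 (lift_edge i e')) //= eqxx mul1r big1 ?addr0 // => e ne.
  by rewrite eq_sym (negbTE ne) mul0r.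
rewrite -!avgE !mulr_sumr -big_split; apply: eq_bigr => e _ /=.
by rewrite mulrDl -!mulrA.
Qed.

(** For a single product with means [a] and [b] over the two parts, the uniform law gives
    [(th a + (1 - th) b)^K] and the split law [th a^K + (1 - th) b^K]. Convexity compares them for
    each [w]. *)
Lemma prod_kernel_split_ge (t : {ffun 'I_K -> J} -> R) : prod_kernel t ->
  avg t <= \sum_e split_density e * t e.
Proof.
case=> W [p [h [p0 h0 te]]].
have -> : avg t = \sum_w p w * avg (h w) ^+ K.
  rewrite /avg; under eq_bigr do rewrite te.
  rewrite exchange_big mulr_suml /=; apply: eq_bigr => w _.
  by rewrite -mulr_sumr -mulrA -avg_ffun_prod.
under [leRHS]eq_bigr do rewrite te mulr_sumr.
rewrite exchange_big; apply: ler_sum => w _ /=.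
under eq_bigr do rewrite mulrCA.
rewrite -mulr_sumr ler_wpM2l // sum_split_density avg_split.
have avgE (J' : finType) (i : J' -> J) :
    avg ((fun e => \prod_k h w (e k)) \o lift_edge i) = avg (h w \o i) ^+ K.
  rewrite -avg_ffun_prod; apply: eq_avg => e /=.
  by apply: eq_bigr => k _; rewrite ffunE.
by rewrite !avgE convex_exprn //; apply: avg_ge0 => j /=.
Qed.

(* Expand [ln (1 - t)] in powers of the kernel [t]: each power is again a
   combination of product kernels, and it enters with a negative sign. *)
Lemma ln1B_kernel_split_le (t : {ffun 'I_K -> J} -> R) : prod_kernel t ->
  (forall e, t e < 1) ->
  \sum_e split_density e * ln (1 - t e) <= avg (fun e => ln (1 - t e)).
Proof.
move=> tK t1; have t01 e : 0 <= t e < 1 by rewrite prod_kernel_ge0 ?t1.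
(* With [d] the signed difference of the two laws, the claim is nonnegativity of one finite sum,
   obtained as a limit over truncated series. *)
pose d e := split_density e - #|{ffun 'I_K -> J}|%:R^-1.
have dE G : \sum_e d e * G e = \sum_e split_density e * G e - avg G.
  rewrite /avg mulr_suml -sumrB; apply: eq_bigr => e _.
  by rewrite mulrBl [G e * _]mulrC.
suff: 0 <= \sum_e d e * - ln (1 - t e).
  under eq_bigr do rewrite mulrN.
  by rewrite sumrN dE opprB subr_ge0.
pose p n : {poly R} := \poly_(i < n.+1) i%:R^-1.
have cv : (fun n => \sum_e d e * (p n).[t e]) @ \oo --> \sum_e d e * - ln (1 - t e).
  apply: cvg_big => [|e _]; first exact: add_continuous.
  by apply: cvgM; [exact: cvg_cst|exact: cvg_ln1B_poly].
rewrite -(cvg_lim _ cv) //; apply: limr_ge; first by apply/cvg_ex; eexists; exact: cv.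
apply: nearW => n; under eq_bigr do rewrite horner_poly mulr_sumr.
rewrite exchange_big sumr_ge0 // => i _.
under eq_bigr do rewrite mulrCA.
rewrite -mulr_sumr mulr_ge0 ?invr_ge0 // dE subr_ge0.
exact/prod_kernel_split_ge/prod_kernelX.
Qed.

End SplitEdges.

(** * Expectations over independent letters *)

Section IteratedExpectation.
Variables (R : numFieldType) (T : finType).
Implicit Types (p q : T -> R) (F G : seq T -> R).

(** For a probability law [p], the expectation of [F] over [m] independent letters, unfolded letter
    by letter so that an induction can change one law at a time. *)
Fixpoint iter_exp p m F : R :=
  if m is m'.+1 then \sum_e p e * iter_exp p m' (fun s => F (e :: s))
  else F [::].

Lemma iter_exp_sum p m (I : finType) (c : I -> R) (F : I -> seq T -> R) :
  iter_exp p m (fun s => \sum_i c i * F i s) = \sum_i c i * iter_exp p m (F i).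
Proof.
elim: m F => [|m IH] F //=; under eq_bigr do rewrite IH mulr_sumr.
rewrite exchange_big; apply: eq_bigr => i _ /=.
by rewrite mulr_sumr; apply: eq_bigr => e _; rewrite mulrCA.
Qed.

Lemma ler_iter_exp p m F G : (forall e, 0 <= p e) -> (forall s, F s <= G s) ->
  iter_exp p m F <= iter_exp p m G.
Proof.
move=> p0; elim: m F G => [|m IH] F G FG //=.
by apply: ler_sum => e _; rewrite ler_wpM2l // IH.
Qed.

Definition perm_invariant F := forall s s', perm_eq s s' -> F s = F s'.

Lemma perm_invariant_cons F e :
  perm_invariant F -> perm_invariant (fun s => F (e :: s)).
Proof. by move=> Fi s s' ss'; apply: Fi; rewrite perm_cons. Qed.

(* Interpolation: the letters are switched from [q] to [p] one at a time. *)
Lemma iter_exp_replace p q m F : (forall e, 0 <= p e) -> (forall e, 0 <= q e) ->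
  perm_invariant F ->
  (forall s, \sum_e q e * F (e :: s) <= \sum_e p e * F (e :: s)) ->
  iter_exp q m F <= iter_exp p m F.
Proof.
move=> p0 q0; elim: m F => [|m IH] F Fi qp //=.
(* The first letter changes law while the others keep [q]: its sum is moved inside the expectation,
   where the hypothesis applies pointwise. *)
apply: (@le_trans _ _ (\sum_e p e * iter_exp q m (fun s => F (e :: s)))).
  by rewrite -!(iter_exp_sum _ _ _ (fun e s => F (e :: s))) ler_iter_exp.
apply: ler_sum => e _; apply: ler_wpM2l => //.
apply: IH => [|s]; first exact: perm_invariant_cons.
(* Moving the fixed [e] behind the varying letter makes the hypothesis at [e :: s] applicable. *)
have Fswap e' : F (e :: e' :: s) = F (e' :: e :: s).
  by apply: Fi; apply/permP => a /=; rewrite addnCA.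
by under eq_bigr do rewrite Fswap; under [leRHS]eq_bigr do rewrite Fswap.
Qed.

Definition unif (_ : T) : R := #|T|%:R^-1.

Lemma unif_ge0 e : 0 <= unif e. Proof. by rewrite invr_ge0. Qed.

Lemma sum_unif (G : T -> R) : \sum_e unif e * G e = avg G.
Proof. by rewrite -mulr_sumr mulrC. Qed.

End IteratedExpectation.

(** * Binomial number of letters from the first part *)

Lemma binprob_rec (R : realType) m (th : R) (g : nat -> R) :
  \sum_(k < m.+2) binprob m.+1 th k * g k =
  th * (\sum_(k < m.+1) binprob m th k * g k.+1) +
  (1 - th) * (\sum_(k < m.+1) binprob m th k * g k).
Proof.
have -> : \sum_(k < m.+1) binprob m th k * g k =
          \sum_(k < m.+2) binprob m th k * g k.
  by rewrite [RHS]big_ord_recr /= /binprob bin_small // !mul0r addr0.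
(* The term [k = 0] arises only from a failed first trial; the others combine by Pascal's rule. *)
rewrite big_ord_recl [X in (1 - th) * X]big_ord_recl /= mulrDr addrCA; congr (_ + _).
  by rewrite /binprob !bin0 !subn0 exprS !expr0; ring.
rewrite !mulr_sumr -big_split; apply: eq_bigr => -[j /= jm] _.
rewrite !mulrA -mulrDl; congr (_ * _).
rewrite /binprob /bump /= add1n subSS binS natrD exprS.
(* The case [j = m] is apart: there [m - j.+1] is truncated, but ['C(m, j.+1)] vanishes. *)
move: jm; rewrite ltnS leq_eqVlt => /predU1P[->|jm].
  by rewrite bin_small // subnn; ring.
by rewrite -(subnSK jm) exprS; ring.
Qed.

Section SplitExpectation.
Variables (R : realType) (T T1 T2 : finType).
Variables (l1 : T1 -> T) (l2 : T2 -> T) (th : R) (p : T -> R).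
Hypotheses (T1_gt0 : (0 < #|T1|)%N) (T2_gt0 : (0 < #|T2|)%N).
Hypothesis sum_p : forall G : T -> R,
  \sum_e p e * G e = th * avg (G \o l1) + (1 - th) * avg (G \o l2).

(** Condition on the first letter: one from [T1] is absorbed into [F1]; one from [T2] is absorbed
    into [F2], after permutation invariance carries it past the letters of [T1]. The weights then
    follow [binprob_rec]. *)
Lemma iter_exp_split m F F1 F2 : perm_invariant F ->
  (forall s1 s2, F (map l1 s1 ++ map l2 s2) = F1 s1 + F2 s2) ->
  iter_exp p m F = \sum_(k < m.+1) binprob m th k *
    (iter_exp (@unif R T1) k F1 + iter_exp (@unif R T2) (m - k) F2).
Proof.
elim: m F F1 F2 => [|m IH] F F1 F2 Fi F12.
  rewrite big_ord1 /binprob bin0 subnn !expr0 !mul1r /=.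
  exact: F12 [::] [::].
have F1E e1 : iter_exp p m (fun s => F (l1 e1 :: s)) =
    \sum_(k < m.+1) binprob m th k *
    (iter_exp (@unif R T1) k (fun s => F1 (e1 :: s)) +
     iter_exp (@unif R T2) (m - k) F2).
  apply: IH => [|s1 s2]; first exact: perm_invariant_cons.
  exact: F12 (e1 :: s1) s2.
have F2E e2 : iter_exp p m (fun s => F (l2 e2 :: s)) =
    \sum_(k < m.+1) binprob m th k *
    (iter_exp (@unif R T1) k F1 +
     iter_exp (@unif R T2) (m - k) (fun s => F2 (e2 :: s))).
  apply: IH => [|s1 s2]; first exact: perm_invariant_cons.
  rewrite -F12; apply: Fi; apply/permP => a /=.
  by rewrite !count_cat /= addnCA.
have avg_sum (T' : finType) (c : 'I_m.+1 -> R) (G : 'I_m.+1 -> T' -> R) :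
    avg (fun x => \sum_k c k * G k x) = \sum_k c k * avg (G k).
  rewrite /avg exchange_big mulr_suml; apply: eq_bigr => k _ /=.
  by rewrite -mulr_sumr mulrA.
rewrite (binprob_rec _ _ (fun k =>
  iter_exp (@unif R T1) k F1 + iter_exp (@unif R T2) (m.+1 - k) F2)).
rewrite [LHS]/= sum_p (eq_avg F1E) (eq_avg F2E) !avg_sum.
congr (_ * _ + _ * _); apply: eq_bigr => k _.
  by rewrite avgD avg_cst // subSS /= sum_unif.
rewrite avgD avg_cst // subSn; last by rewrite -ltnS.
by rewrite // /= sum_unif.
Qed.

End SplitExpectation.

(** * Partition functions, disjoint unions and adding an edge *)

Section PartitionFunction.
Variables (R : realType) (K : nat) (X : finType).
Variables (hw : X -> R) (w : {ffun 'I_K -> bool} -> {ffun 'I_K -> X} -> R).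

(** Each end carries its vertex together with its sign bit, so a uniform signed edge still has
    independent, identically distributed ends. *)
Definition edge_weight n (e : {ffun 'I_K -> 'I_n * bool}) (x : {ffun 'I_n -> X}) :=
  w [ffun k => (e k).2] [ffun k => x (e k).1].

Definition config_weight n s (x : {ffun 'I_n -> X}) :=
  \prod_i hw (x i) * \prod_(e <- s) edge_weight e x.

Definition part_fun n s : R := \sum_(x : {ffun 'I_n -> X}) config_weight s x.

Lemma part_fun_perm n s s' : perm_eq s s' -> part_fun (n := n) s = part_fun s'.
Proof.
by move=> ss'; apply: eq_bigr => x _; rewrite /config_weight (perm_big _ ss').
Qed.

Section TwoParts.
Variables (n1 n2 : nat).

Definition incl1 (j : 'I_n1 * bool) : 'I_(n1 + n2) * bool := (lshift n2 j.1, j.2).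
Definition incl2 (j : 'I_n2 * bool) : 'I_(n1 + n2) * bool := (rshift n1 j.1, j.2).

(** No edge joins the two parts, and a configuration of the union is a pair of configurations, so
    weights factor. *)
Lemma part_fun_split s1 s2 :
  part_fun (map (lift_edge incl1) s1 ++ map (lift_edge incl2) s2) =
  part_fun s1 * part_fun s2.
Proof.
pose join (x : {ffun 'I_n1 -> X} * {ffun 'I_n2 -> X}) : {ffun 'I_(n1 + n2) -> X} :=
  [ffun i : 'I_(n1 + n2) => match fintype.split i with inl a => x.1 a | inr b => x.2 b end].
pose cut (x : {ffun 'I_(n1 + n2) -> X}) : {ffun 'I_n1 -> X} * {ffun 'I_n2 -> X} :=
  ([ffun a => x (lshift n2 a)], [ffun b => x (rshift n1 b)]).
have joinl x a : join x (lshift n2 a) = x.1 a.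
  by rewrite ffunE (unsplitK (inl a)).
have joinr x b : join x (rshift n1 b) = x.2 b.
  by rewrite ffunE (unsplitK (inr b)).
have liftE (I J : finType) (i : I -> J) (e : {ffun 'I_K -> I}) k :
    lift_edge i e k = i (e k) by rewrite ffunE.
have cutK : cancel cut join.
  move=> x; apply/ffunP => i; rewrite ffunE.
  by case: split_ordP => a ->; rewrite ffunE.
have joinK : cancel join cut.
  by case=> x1 x2; congr (_, _); apply/ffunP => i; rewrite ffunE ?joinl ?joinr.
rewrite /part_fun big_distrlr pair_big /=.
rewrite (reindex join); last by exists cut => x _.
apply: eq_bigr => x _; rewrite /config_weight big_split_ord /= big_cat !big_map /=.
rewrite mulrACA; congr (_ * _ * (_ * _)); apply: eq_bigr => i _;
  rewrite ?joinl ?joinr // /edge_weight; congr (w _ _); apply/ffunP => k;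
  by rewrite ffunE [RHS]ffunE liftE ?joinl ?joinr.
Qed.

Lemma avg_incl (h : 'I_(n1 + n2) * bool -> R) : (0 < n1)%N -> (0 < n2)%N ->
  let th := n1%:R / (n1 + n2)%:R in
  avg h = th * avg (h \o incl1) + (1 - th) * avg (h \o incl2).
Proof.
move=> n1_gt0 n2_gt0 th; rewrite /avg !card_prod !card_ord card_bool !natrM.
have sumE n (f : 'I_n * bool -> R) : \sum_j f j = \sum_i \sum_b f (i, b).
  by rewrite pair_bigA; apply: eq_bigr => -[].
rewrite !sumE big_split_ord /=.
set S1 := \sum_(i < n1) _; set S2 := \sum_(i < n2) _.
rewrite /th natrD; field.
by rewrite -natrD !pnatr_eq0 -!lt0n addn_gt0 n1_gt0 n2_gt0.
Qed.

End TwoParts.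

Variable x0 : X.
Hypothesis hw_gt0 : forall x, 0 < hw x.
Hypothesis w_ge0 : forall a y, 0 <= w a y.
Hypothesis w_x0 : forall a, 0 < w a [ffun=> x0].

Lemma config_weight_ge0 n s (x : {ffun 'I_n -> X}) : 0 <= config_weight s x.
Proof. by rewrite mulr_ge0 ?prodr_ge0 // => i _; [rewrite ltW|rewrite w_ge0]. Qed.

(** Hard constraints may kill configurations, but the constant one at [x0] keeps positive weight. *)
Lemma part_fun_gt0 n s : 0 < part_fun (n := n) s.
Proof.
rewrite /part_fun (bigD1 [ffun=> x0]) //=; apply: ltr_pwDl; last first.
  by apply: sumr_ge0 => x _; exact: config_weight_ge0.
rewrite mulr_gt0 ?prodr_gt0 // => e _.
rewrite /edge_weight (_ : [ffun k => _] = [ffun=> x0] :> {ffun 'I_K -> X}) //.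
by apply/ffunP => k; rewrite !ffunE.
Qed.

Variables (T : finType) (C kap : R) (g : T -> bool -> X -> R).
Hypotheses (C_gt0 : 0 < C) (kap_ge0 : 0 <= kap).
Hypothesis g_ge0 : forall c b x, 0 <= g c b x.
Hypothesis wE : forall a y,
  w a y = C * (1 - kap * \sum_c \prod_k g c (a k) (y k)).

(* The Gibbs average of the edge factor of a new edge, divided by [C],
   is [1 - gibbs_kernel]. *)
Definition gibbs_kernel n s (e : {ffun 'I_K -> 'I_n * bool}) : R :=
  \sum_(xc : {ffun 'I_n -> X} * T)
    kap * config_weight s xc.1 / part_fun (n := n) s *
    \prod_k g xc.2 (e k).2 (xc.1 (e k).1).

Lemma prod_kernel_gibbs n s : prod_kernel (gibbs_kernel (n := n) s).
Proof.
exists ({ffun 'I_n -> X} * T)%type.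
exists (fun xc => kap * config_weight s xc.1 / part_fun s).
exists (fun (xc : {ffun 'I_n -> X} * T) (j : 'I_n * bool) => g xc.2 j.2 (xc.1 j.1)); split=> // xc.
apply: mulr_ge0; last by rewrite invr_ge0 ltW ?part_fun_gt0.
by apply: mulr_ge0; last exact: config_weight_ge0.
Qed.

(** The ratio of the two partition functions is the Gibbs mean of the factor of [e], which [wE]
    expands. *)
Lemma part_fun_cons n s (e : {ffun 'I_K -> 'I_n * bool}) :
  part_fun (e :: s) = C * part_fun s * (1 - gibbs_kernel s e).
Proof.
have Z0 : part_fun (n := n) s != 0 by rewrite gt_eqF ?part_fun_gt0.
have ZgE : part_fun s * gibbs_kernel s e = \sum_x config_weight s x *
    (kap * \sum_c \prod_k g c (e k).2 (x (e k).1)).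
  rewrite /gibbs_kernel -(pair_bigA _ (fun x c =>
    kap * config_weight s x / part_fun s * \prod_k g c (e k).2 (x (e k).1))) /=.
  rewrite mulr_sumr; apply: eq_bigr => x _.
  by rewrite !mulr_sumr; apply: eq_bigr => c _; field.
rewrite -mulrA mulrBr mulr1 ZgE -sumrB mulr_sumr; apply: eq_bigr => x _.
rewrite /config_weight big_cons /edge_weight wE.
rewrite [X in C * (1 - kap * X)](eq_bigr (fun c => \prod_k g c (e k).2 (x (e k).1))).
  by ring.
by move=> c _; apply: eq_bigr => k _; rewrite !ffunE.
Qed.

(** Forced by positivity of the partition function after [e] is added. *)
Lemma gibbs_kernel_lt1 n s (e : {ffun 'I_K -> 'I_n * bool}) : gibbs_kernel s e < 1.
Proof.
have := part_fun_gt0 (e :: s).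
by rewrite part_fun_cons pmulr_rgt0 ?subr_gt0 // mulr_gt0 ?part_fun_gt0.
Qed.

Lemma ln_part_fun_cons n s (e : {ffun 'I_K -> 'I_n * bool}) :
  ln (part_fun (e :: s)) = ln (C * part_fun s) + ln (1 - gibbs_kernel s e).
Proof.
by rewrite part_fun_cons lnM ?posrE ?subr_gt0 ?gibbs_kernel_lt1 ?mulr_gt0 ?part_fun_gt0.
Qed.

Definition expected_log_part_fun n m :=
  iter_exp (@unif R {ffun 'I_K -> 'I_n * bool}) m (fun s => ln (part_fun s)).

Lemma expected_log_part_fun_superadd n1 n2 m : (0 < n1)%N -> (0 < n2)%N ->
  \sum_(k < m.+1) binprob m (n1%:R / (n1 + n2)%:R) k *
    (expected_log_part_fun n1 k + expected_log_part_fun n2 (m - k))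
  <= expected_log_part_fun (n1 + n2) m.
Proof.
move=> n1_gt0 n2_gt0; set th := n1%:R / _.
have th01 : 0 <= th <= 1.
  rewrite divr_ge0 //= ler_pdivrMr ?ltr0n ?addn_gt0 ?n1_gt0 // mul1r ler_nat.
  exact: leq_addr.
have avg_h h := @avg_incl n1 n2 h n1_gt0 n2_gt0.
have edges_gt0 n : (0 < n)%N -> (0 < #|{ffun 'I_K -> 'I_n * bool}|)%N.
  by move=> n0; rewrite card_ffun expn_gt0 card_prod !card_ord card_bool muln_gt0 n0.
pose q := @split_density R _ _ _ K (@incl1 n1 n2) (@incl2 n1 n2) th.
have sum_q := @sum_split_density R _ _ _ K (@incl1 n1 n2) (@incl2 n1 n2) th.
have inv : perm_invariant (fun s => ln (part_fun (n := n1 + n2) s)).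
  by move=> s s' /part_fun_perm ->.
(* The binomial sum is the expectation with every edge of law [q]; it remains to switch the edges to
   the uniform law. *)
rewrite -(iter_exp_split (p := q) (l1 := lift_edge (@incl1 n1 n2))
  (l2 := lift_edge (@incl2 n1 n2)) (edges_gt0 _ n1_gt0) (edges_gt0 _ n2_gt0) sum_q
  m inv); last first.
  by move=> s1 s2; rewrite part_fun_split lnM ?posrE ?part_fun_gt0.
apply: iter_exp_replace => // [e|e|s]; first exact: unif_ge0.
  exact: split_density_ge0.
(* For one new edge, [ln (C * part_fun s)] contributes equally under both laws, [q] having mass 1;
   only [ln (1 - gibbs_kernel s e)] is left to compare. *)
rewrite sum_unif (eq_avg (ln_part_fun_cons s)) avgD.
rewrite avg_cst ?edges_gt0 ?addn_gt0 ?n1_gt0 //.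
under eq_bigr do rewrite ln_part_fun_cons mulrDr.
rewrite big_split /= lerD //.
  by rewrite sum_q !avg_cst ?edges_gt0 // -mulrDl addrC subrK mul1r.
apply: ln1B_kernel_split_le => //; first exact (prod_kernel_gibbs s).
by move=> e; exact: gibbs_kernel_lt1.
Qed.

End PartitionFunction.

(** * From iterated expectations to [ElogZ] *)

Lemma iter_exp_unifE (R : numFieldType) (T : finType) m (F : seq T -> R) :
  iter_exp (@unif R T) m F =
  avg (fun f : {ffun 'I_m -> T} => F [seq f i | i <- enum 'I_m]).
Proof.
rewrite /avg card_ffun card_ord.
elim: m F => [|m IH] F /=.
  rewrite divr1 (big_pred1 [ffun i : 'I_0 => False_rect T (notF (ltn_ord i))]).
    by rewrite (size0nil (size_enum_ord 0)).
  by move=> f; apply/esym/eqP/ffunP => -[].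
(* A family is split into its first letter and the rest, matching one unfolding of [iter_exp]. *)
pose join (p : T * {ffun 'I_m -> T}) : {ffun 'I_m.+1 -> T} :=
  [ffun i => oapp p.2 p.1 (unlift ord0 i)].
pose cut (f : {ffun 'I_m.+1 -> T}) := (f ord0, [ffun i => f (lift ord0 i)]).
have cutK : cancel cut join.
  move=> f; apply/ffunP => i; rewrite ffunE.
  by case: unliftP => [j ->|->] //=; rewrite ffunE.
have joinK : cancel join cut.
  case=> e f; congr (_, _); first by rewrite ffunE unlift_none.
  by apply/ffunP => i; rewrite !ffunE liftK.
rewrite [in RHS](reindex join); last by exists cut => x _.
rewrite -(pair_bigA _ (fun e f => F [seq join (e, f) i | i <- enum 'I_m.+1])).
rewrite /= mulr_suml; apply: eq_bigr => e _.
rewrite IH /unif mulrCA expnS natrM invfM; congr (_ * _); apply: eq_bigr => f _.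
rewrite enum_ordSl /= ffunE unlift_none -map_comp; congr (F (_ :: _)).
by apply: eq_map => i; rewrite /= ffunE liftK.
Qed.

Lemma prod_indicator (R : comNzRingType) n (P : pred 'I_n) :
  \prod_k (P k)%:R = [forall k, P k]%:R :> R.
Proof.
case: forallP => [h|/forallP]; first by rewrite big1 // => k _; rewrite h.
by rewrite negb_forall => /existsP[k /negbTE Pk]; rewrite (bigD1 k) //= Pk mul0r.
Qed.

(** The two patterns are complementary, hence exclusive once there is a coordinate, so the indicator
    of their union is a sum; [c] selects the pattern. *)
Lemma nae_indicator (R : comNzRingType) K (a : {ffun 'I_K -> bool})
    (y : {ffun 'I_K -> 'I_2}) : (0 < K)%N ->
  ([forall k, val (y k) == nat_of_bool (a k)] ||
   [forall k, val (y k) == nat_of_bool (~~ a k)])%:R =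
  \sum_(c : bool) \prod_k (val (y k) == nat_of_bool (c (+) a k))%:R :> R.
Proof.
move=> K_gt0; set A := [forall k, _]; set B := [forall k, _].
have -> : \sum_(c : bool) \prod_k (val (y k) == nat_of_bool (c (+) a k))%:R =
          B%:R + A%:R :> R.
  by rewrite big_bool; congr (_ + _); exact: prod_indicator.
have : ~~ (A && B).
  apply/negP => /andP[/forallP yA /forallP yN]; pose i := Ordinal K_gt0.
  by have := yA i; rewrite (eqP (yN i)); case: (a i).
by case: A; case: B => //= _; rewrite ?addr0 ?add0r.
Qed.

Section Spec.
Variables (R : realType) (lam : R).
Hypothesis lam_gt0 : 0 < lam.

Lemma owtD a b : owt lam (oadd a b) = owt lam a * owt lam b.
Proof.
case: a b => [a|] [b|] /=; rewrite ?mul0r ?mulr0 // powRD //.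
by rewrite (gt_eqF lam_gt0) implybT.
Qed.

Lemma owt_ge0 a : 0 <= owt lam a.
Proof. by case: a => //= a; exact: powR_ge0. Qed.

Lemma owt_Hamil (S : spec R) n m
    (f : {ffun 'I_m -> {ffun 'I_(sK S) -> 'I_n * bool}}) x :
  owt lam (Hamil [ffun e => [ffun k => (f e k).1]]
                 [ffun e => [ffun k => (f e k).2]] x) =
  config_weight (fun s => powR lam (sh s)) (fun a y => owt lam (se a y))
    [seq f e | e <- enum 'I_m] x.
Proof.
rewrite /Hamil owtD /config_weight /=; congr (_ * _).
  rewrite (big_morph (powR lam) (id1 := 1) (op1 := *%R)) ?powRr0 // => a b.
  exact: owtD (Some a) (Some b).
rewrite (big_morph (owt lam) owtD (powRr0 lam : owt lam (Some 0) = 1)) big_map big_enum /=.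
apply: eq_bigr => e _; rewrite /edge_weight; congr (owt lam (se _ _)).
  by rewrite ffunE.
by apply/ffunP => k; rewrite !ffunE.
Qed.

(** Attaching sign bits to ends is a bijection, so independent uniform hyperedges and signs amount
    to uniform signed edges. *)
Lemma ElogZE (M : model R) n m :
  ElogZ M lam n m =
  expected_log_part_fun (fun s => powR lam (sh s))
    (fun a y => owt lam (se (s := model_spec M) a y)) n m.
Proof.
rewrite /ElogZ /expected_log_part_fun iter_exp_unifE; set S := model_spec M.
rewrite pair_bigA /avg -natrM; congr (_ / _%:R); last first.
  by rewrite !card_ffun card_prod !card_ord card_bool -!expnMn.
pose unzip (f : {ffun 'I_m -> {ffun 'I_(sK S) -> 'I_n * bool}}) :=
  ([ffun e => [ffun k => (f e k).1]], [ffun e => [ffun k => (f e k).2]]).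
pose zip (p : {ffun 'I_m -> {ffun 'I_(sK S) -> 'I_n}} *
              {ffun 'I_m -> {ffun 'I_(sK S) -> bool}}) :
  {ffun 'I_m -> {ffun 'I_(sK S) -> 'I_n * bool}} :=
  [ffun e => [ffun k => (p.1 e k, p.2 e k)]].
rewrite (reindex unzip) /=; last first.
  exists zip => [f|[E A]] _.
    by do 2 apply/ffunP => ?; rewrite !ffunE -surjective_pairing.
  by congr (_, _); do 2 apply/ffunP => ?; rewrite !ffunE.
by apply: eq_bigr => f _; congr ln; apply: eq_bigr => x _; exact: owt_Hamil.
Qed.

(** What the interpolation asks of a model: the first part keeps the partition function positive,
    the second makes the Gibbs kernel a product kernel. *)
Definition repulsive_edges (S : spec R) :=
  (exists x0, forall a, 0 < owt lam (se (s := S) a [ffun=> x0])) /\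
  exists (T : finType) (C kap : R) (g : T -> bool -> 'I_(sq S) -> R),
  [/\ 0 < C, 0 <= kap, forall c b x, 0 <= g c b x &
      forall a y, owt lam (se (s := S) a y) =
        C * (1 - kap * \sum_c \prod_k g c (a k) (y k))].

Lemma ElogZ_superadd (M : model R) n1 n2 m : repulsive_edges (model_spec M) ->
  (0 < n1)%N -> (0 < n2)%N ->
  \sum_(k < m.+1) binprob m (n1%:R / (n1 + n2)%:R) k *
    (ElogZ M lam n1 k + ElogZ M lam n2 (m - k)) <= ElogZ M lam (n1 + n2) m.
Proof.
move=> [[x0 x0P] [T [C [kap [g [C0 kap0 g0 wE]]]]]] n1_gt0 n2_gt0.
under eq_bigr do rewrite !ElogZE.
rewrite ElogZE; apply: (expected_log_part_fun_superadd _ _ x0P C0 kap0 g0 wE) => //.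
  by move=> x; exact: powR_gt0.
by move=> a y; exact: owt_ge0.
Qed.

End Spec.

(** * The six models *)

Section Models.
Variables (R : realType) (lam : R).
Hypothesis lam_gt1 : 1 < lam.
Let lam_gt0 : 0 < lam := lt_trans ltr01 lam_gt1.

(** Equality of the two ends is the sum over colours [c] of the product of the indicators of [c],
    and [kap] is chosen so that [C (1 - kap)] is the weight of agreement. This covers MAX-CUT, Ising
    and coloring. *)
Lemma repulsive_potts q (hs : 'I_q -> R)
    (ed : {ffun 'I_2 -> bool} -> {ffun 'I_2 -> 'I_q} -> option R) (u v : R) :
  (0 < q)%N -> u < v ->
  (forall a y, ed a y = Some (if y e0 == y e1 then u else v)) ->
  repulsive_edges lam (@Spec R 2 q hs ed).
Proof.
move=> q0 uv edE; have vgt0 : 0 < lam `^ v by exact: powR_gt0.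
split; first by exists (Ordinal q0) => a /=; rewrite edE; exact: powR_gt0.
exists 'I_q, (lam `^ v), (1 - lam `^ u / lam `^ v), (fun c _ x => (x == c)%:R).
split=> //= [|a y]; last rewrite edE.
  by rewrite subr_ge0 ler_pdivrMr // mul1r ler_powR // ltW.
have -> : \sum_c \prod_(k < 2) (y k == c)%:R = (y e0 == y e1)%:R :> R.
  rewrite (bigD1 (y e0)) //= [X in _ + X]big1 => [|c ne].
    rewrite addr0 big_ord_recl big_ord1 eqxx mul1r eq_sym.
    by congr ((_ == y _)%:R); exact: val_inj.
  by rewrite big_ord_recl eq_sym (negbTE ne) mul0r.
case: ifP => _ /=; last by rewrite mulr0 subr0 mulr1.
by field; rewrite gt_eqF.
Qed.

Lemma model_repulsive (M : model R) : model_ok M ->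
  repulsive_edges lam (model_spec M).
Proof.
have kap_ge0 : 0 <= 1 - lam^-1 by rewrite subr_ge0 invf_le1 // ltW.
have lamE (b : bool) : lam `^ (if b then 0 else 1) = lam * (1 - (1 - lam^-1) * b%:R).
  case: b; rewrite ?powRr0 ?powRr1 ?ltW //; last by rewrite mulr0 subr0 mulr1.
  by rewrite /=; field; rewrite gt_eqF.
case: M => [|| beta B | q | K | K] /= ok.
(* The constant configuration is the empty set; [kap = 1] kills an edge with both ends occupied. *)
- split.
    by exists ord0 => a /=; rewrite ffunE /= powRr0.
  exists unit, 1, 1, (fun _ _ x => (val x == 1%N)%:R); split=> // a y.
  rewrite (big_pred1 tt) => [|[] //]; rewrite big_ord_recl big_ord1 /= -natrM mulnb.
  have -> : lift ord0 ord0 = e1 by exact: val_inj.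
  by rewrite /e0; case: (_ && _) => /=; rewrite ?powRr0 !mul1r ?subrr ?subr0.
- by apply: (@repulsive_potts _ _ _ 0 1) => // a y; rewrite if_neg.
- by apply: (@repulsive_potts _ _ _ (- beta) beta) => //; rewrite gtrN.
- by apply: (@repulsive_potts _ _ _ 0 1) => // [|a y]; rewrite ?if_neg // ltnW.
- split; first by exists ord0 => a /=; exact: powR_gt0.
  (* The violating assignment is a product of indicators over the ends, and [kap] lowers the weight
     from [lam] to 1. *)
  exists unit, lam, (1 - lam^-1), (fun _ b x => (val x == nat_of_bool b)%:R).
  split=> // a y; rewrite (big_pred1 tt) => [|[] //].
  by rewrite (prod_indicator _ (fun k => val (y k) == a k)) /= lamE.
- split; first by exists ord0 => a /=; exact: powR_gt0.
  exists bool, lam, (1 - lam^-1), (fun c b x => (val x == nat_of_bool (c (+) b))%:R).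
  split=> // a y; rewrite [LHS]lamE; congr (_ * (1 - _ * _)).
  exact: nae_indicator a y (ltnW ok).
Qed.

End Models.

Theorem theorem6 (R : realType) (M : model R) (c lam : R) (N N1 N2 : nat) :
  0 < c -> 1 < lam -> model_ok M ->
  (1 <= N1 <= N - 1)%N -> (1 <= N2 <= N - 1)%N -> (N1 + N2)%N = N ->
  let m := Num.truncn (c * N%:R) in
  \sum_(k < m.+1) binprob m (N1%:R / N%:R) k * ElogZ M lam N1 k
  + \sum_(k < m.+1) binprob m (N1%:R / N%:R) k * ElogZ M lam N2 (m - k)
  <= ElogZ M lam N m.
Proof.
move=> _ lam1 okM /andP[N1_gt0 _] /andP[N2_gt0 _] <- /=.
rewrite -big_split; under eq_bigr do rewrite /= -mulrDr.
have lam0 : 0 < lam := lt_trans ltr01 lam1.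
exact: (ElogZ_superadd lam0 _ (model_repulsive lam1 okM)).
Qed.
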